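(* Let $A,\delta A$ be two $n\times n$ real symmetric matrices. Let $\lambda_1\ge\dots\ge\lambda_n$ be the eigenvalues of $A+\delta A$ and $\mu_1\ge\dots\ge\mu_n$ the eigenvalues of $A$ (with multiplicity). Let $\Delta=\min\{|\mu_i-\mu_j|:\mu_i\ne\mu_j\}$ be the smallest gap between distinct eigenvalues of $A$. Assume that $\rho(\delta A)<\frac{\Delta}{2}$. Let $i\in\{1,\dots,n\}$ and let $\mathbf v_i$ be any normed eigenvector of $A+\delta A$ corresponding to the eigenvalue $\lambda_i$. Then: 1. $|\lambda_i-\mu_i|\le\rho(\delta A)$; 2. the dimension of the eigenspace of $A+\delta A$ corresponding to the eigenvalue $\lambda_i$ is no larger than the dimension of the eigenspace of $A$ corresponding to the eigenvalue $\mu_i$; 3. there exists a normed eigenvector $\widehat{\mathbf v}_i$ of $A$ corresponding to the eigenvalue $\mu_i$ such that $$\mathbf v_i\cdot\widehat{\mathbf v}_i\ge\sqrt{1-\left(\frac{\rho(\delta A)}{\Delta/2}\right)^2}.$$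
   Context: $\rho(X)$ denotes the spectral radius of a matrix $X$. ''Normed'' means of Euclidean norm $1$. *)

(* Defs.v *)
From HB Require Import structures.
From mathcomp Require Import all_boot all_order all_algebra.
From mathcomp Require Import complex.
From mathcomp Require Import boolp classical_sets constructive_ereal reals.

Set Implicit Arguments.
Unset Strict Implicit.
Unset Printing Implicit Defensive.

Import Order.TTheory GRing.Theory Num.Theory.
Local Open Scope ring_scope.

(* Vectors are rows, as in [mxalgebra], whose [eigenspace M a] consists of the
   rows [v] with [v *m M = a *: v]. When [M] is symmetric, transposition
   identifies this with the column convention [M *m v = a *: v].              *)

Definition dot (R : realType) (n : nat) (u v : 'rV[R]_n) : R :=
  \sum_(k < n) u 0 k * v 0 k.

(* The norm that MathComp-Analysis puts on matrices is the sup norm. *)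
Definition enorm (R : realType) (n : nat) (v : 'rV[R]_n) : R :=
  Num.sqrt (dot v v).

(* [v] is nonzero because its norm is 1. *)
Definition normed_eigenvector (R : realType) (n : nat)
    (M : 'M[R]_n) (a : R) (v : 'rV[R]_n) : Prop :=
  (v <= eigenspace M a)%MS /\ enorm v = 1.

Definition ordered_eigenvalues (R : realType) (n : nat)
    (M : 'M[R]_n) (l : 'I_n -> R) : Prop :=
  (forall i j : 'I_n, (i <= j)%N -> l j <= l i) /\
  char_poly M = \prod_(i < n) ('X - (l i)%:P).

(* Largest modulus of a complex eigenvalue: for [0 < n] the set is finite and
   nonempty, so that the supremum is a maximum.                               *)
Definition spectral_radius (R : realType) (n : nat) (X : 'M[R]_n) : R :=
  sup [set Normc.normc z |
        z in [set z : R[i] | eigenvalue (map_mx (real_complex R) X) z]]%classic.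

(* The minimum is taken in the extended reals, so that it is [+oo] when all the
   [mu i] coincide; since [inve +oo = 0], a ratio with that denominator is 0. *)
Definition smallest_gap (R : realType) (n : nat) (mu : 'I_n -> R) : \bar R :=
  \big[Order.min/+oo%E]_(p : 'I_n * 'I_n | mu p.1 != mu p.2)
     (`|mu p.1 - mu p.2|)%:E.

(* Main.v *)
Require Import Defs.
From HB Require Import structures.
From mathcomp Require Import all_boot all_order all_fingroup all_algebra.
From mathcomp Require Import complex.
From mathcomp Require Import boolp classical_sets constructive_ereal reals.
From mathcomp Require Import ring lra.

Set Implicit Arguments.
Unset Strict Implicit.
Unset Printing Implicit Defensive.

Import Order.TTheory GRing.Theory Num.Theory.
Local Open Scope ring_scope.

(* Put r = rho(dA). By the spectral theorem |x dA| <= r |x|, so Weyl's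
   inequality gives the first claim. In an orthonormal eigenbasis of A, the
   coordinates of v_i (A - lambda_i) = - v_i dA are those of v_i multiplied by
   mu_k - lambda_i, and |mu_k - lambda_i| >= Delta - r > Delta / 2 when mu_k
   <> mu_i. Hence the component of v_i orthogonal to the eigenspace of mu_i
   has norm at most r / (Delta / 2) < 1, and normalizing the projection onto
   that eigenspace gives the third claim. The second follows from the third,
   as no eigenvector for lambda_i is orthogonal to the eigenspace of mu_i. *)

(** * Spectral theorem for real symmetric matrices *)

(** Over the complex extension [A] is Hermitian, so its spectrum is real, and a real root of the
    characteristic polynomial descends to [R]. *)
Lemma symmetric_eigenvalue (R : rcfType) (n : nat) (A : 'M[R]_n.+1) :
  A^T = A -> exists a, eigenvalue A a.
Proof.
move=> symA; set AC := map_mx (real_complex R) A.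
have realAC : AC \is a mxOver Num.real.
  by apply/mxOverP => i j; rewrite mxE complex_real.
have symAC : AC \is symmetricmx.
  by apply/is_hermitianmxP; rewrite expr0 scale1r map_mx_id //
    /AC map_trmx symA.
have hermAC := realsym_hermsym symAC realAC.
have /mxOverP/(_ 0 0)/complex_realP[a spa] :=
  hermitian_spectral_diag_real hermAC.
have /orthomx_spectralP specAC := symmetric_normalmx symAC realAC.
suff: eigenvalue AC (real_complex R a).
  rewrite eigenvalue_root_char -map_char_poly fmorph_root -eigenvalue_root_char.
  by exists a.
rewrite -spa.
(* The rows of the diagonalizing matrix are left eigenvectors, nonzero because that matrix is
   invertible. *)
apply/eigenvalueP; exists (row 0 (spectralmx AC)).
  rewrite [X in _ *m X]specAC -!mulmxA -row_mul !mulmxA.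
  by rewrite mulmxV ?spectral_unit // mul1mx row_mul row_diag_mx
    -scalemxAl -rowE.
apply: contraTneq (spectral_unit AC) => row0.
have /row_free_inj free : row_free (spectralmx AC).
  by rewrite row_free_unit spectral_unit.
have /free/matrixP/(_ 0 0)/eqP :
    delta_mx 0 0 *m spectralmx AC = (0 : 'rV_n.+1) *m spectralmx AC.
  by rewrite -rowE row0 mul0mx.
by rewrite !mxE oner_eq0.
Qed.

(* The Householder reflection along [u - e_0] exchanges [e_0] and [u]. *)
Lemma orthogonal_completion (R : rcfType) (n : nat) (u : 'rV[R]_n.+1) :
  u *m u^T = 1%:M -> exists2 Q : 'M[R]_n.+1, Q *m Q^T = 1%:M & row 0 Q = u.
Proof.
move=> u1; set e : 'rV[R]_n.+1 := delta_mx 0 0.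
have [w wE] : exists w, w = u - e by exists (u - e).
have ee : e *m e^T = 1%:M.
  by rewrite trmx_delta mul_delta_mx; apply/matrixP => i j; rewrite !ord1 !mxE.
have eu : e *m u^T = (u 0 0)%:M.
  by rewrite -rowE; apply/matrixP => i j; rewrite !ord1 !mxE mulr1n.
have ue : u *m e^T = (u 0 0)%:M.
  by rewrite -[LHS]trmxK trmx_mul trmxK eu tr_scalar_mx.
have [c cE] : exists c, c = 2 - 2 * u 0 0 by exists (2 - 2 * u 0 0).
have ww : w *m w^T = c%:M.
  rewrite wE linearB /= mulmxBl !mulmxBr u1 ee eu ue.
  by apply/matrixP => i j; rewrite !ord1 !mxE !mulr1n cE; ring.
(* [c] is the squared norm of [u - e]; if it vanishes, then [u = e] and the identity serves in place
   of a reflection. *)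
have [c0|cN0] := eqVneq c 0.
  exists 1%:M; first by rewrite trmx1 mulmx1.
  rewrite rowE mulmx1 -/e; apply/esym/eqP; rewrite -subr_eq0 -wE.
  move: ww; rewrite c0 => /matrixP/(_ 0 0); rewrite !mxE eqxx mul0rn => /eqP.
  rewrite psumr_eq0 => [/allP w0|k _]; last by rewrite !mxE -expr2 sqr_ge0.
  apply/eqP/rowP => k; have := w0 k (mem_index_enum k).
  by rewrite !mxE -expr2 sqrf_eq0 => /eqP.
exists (1%:M - (2 / c) *: (w^T *m w)).
  have -> : (1%:M - (2 / c) *: (w^T *m w))^T = 1%:M - (2 / c) *: (w^T *m w).
    by rewrite linearB linearZ /= trmx1 trmx_mul trmxK.
  rewrite mulmxBl mul1mx mulmxBr mulmx1 -scalemxAl -scalemxAr.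
  rewrite mulmxA -(mulmxA w^T) ww mul_mx_scalar -scalemxAl !scalerA.
  have -> : 2 / c * (2 / c * c) = 2 / c + 2 / c by field.
  by rewrite scalerDl opprB addrK subrK.
rewrite rowE -/e mulmxBr mulmx1 -scalemxAr mulmxA {1}wE linearB /=.
rewrite mulmxBr ee eu -scalar_mx_is_additive mul_scalar_mx scalerA.
rewrite (_ : 2 / c * (u 0 0 - 1) = -1) ?scaleN1r ?opprK ?wE ?subrKC //.
rewrite [in LHS]cE; field; apply: contraNneq cN0 => h.
by rewrite cE -h; apply/eqP; ring.
Qed.

(** Induction by deflation: in an orthonormal basis starting with a unit eigenvector, [A] becomes
    block diagonal, and the lower right block is again symmetric. *)
Theorem spectral_theorem (R : rcfType) (n : nat) (A : 'M[R]_n) :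
  A^T = A -> exists P : 'M[R]_n, exists d : 'rV[R]_n,
    P *m P^T = 1%:M /\ A = P^T *m diag_mx d *m P.
Proof.
elim: n A => [|n IHn] A symA.
  by exists 1%:M, 0; split; [rewrite trmx1 mulmx1 | apply/matrixP => -[]].
have [a /eigenvalueP[v0 v0A v0N0]] := symmetric_eigenvalue symA.
pose s := \sum_k v0 0 k ^+ 2.
have s_gt0 : 0 < s.
  rewrite lt0r sumr_ge0 => [|k _]; last exact: sqr_ge0.
  rewrite andbT; apply: contra v0N0.
  rewrite psumr_eq0 => [/allP v00|k _]; last exact: sqr_ge0.
  apply/eqP/rowP => k; have := v00 k (mem_index_enum k).
  by rewrite sqrf_eq0 mxE => /eqP.
set u := (Num.sqrt s)^-1 *: v0.
have uA : u *m A = a *: u by rewrite -scalemxAl v0A !scalerA mulrC.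
have u1 : u *m u^T = 1%:M.
  rewrite linearZ /= -scalemxAl -scalemxAr scalerA.
  have -> : v0 *m v0^T = s%:M.
    rewrite [LHS]mx11_scalar mxE; congr (_%:M).
    by apply: eq_bigr => k _; rewrite mxE expr2.
  by rewrite scale_scalar_mx -invfM -expr2 sqr_sqrtr ?ltW // mulVf // gt_eqF.
have [Q QQ rowQ] := orthogonal_completion u1.
have QQ' := mulmx1C QQ.
have [B BE] : exists B : 'M_(1 + n), B = Q *m A *m Q^T.
  by exists (Q *m A *m Q^T).
have symB : B^T = B by rewrite BE !trmx_mul trmxK symA mulmxA.
have rowB : row 0 B = a *: delta_mx 0 0.
  rewrite BE !row_mul rowQ uA -scalemxAl -rowQ -row_mul QQ; congr (_ *: _).
  by rewrite rowE mulmx1.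
have urB : ursubmx B = 0.
  apply/matrixP => i j; rewrite !mxE; move/rowP/(_ (rshift 1 j)): rowB.
  rewrite ord1 !mxE /= mulr0 => <-; by congr (B _ _); apply: val_inj.
have dlB : dlsubmx B = 0 by rewrite -[dlsubmx B]trmxK trmx_dlsub symB urB trmx0.
have [|P' [d' [PP' defB]]] := IHn (drsubmx B); first by rewrite trmx_drsub symB.
pose S : 'M_(1 + n) := block_mx 1%:M 0 0 P'.
have SS : S *m S^T = 1%:M.
  rewrite /S tr_block_mx !trmx0 trmx1 mulmx_block.
  by rewrite !(mulmx0, mul0mx, mulmx1, addr0, add0r) PP' -scalar_mx_block.
have diagB : B = S^T *m diag_mx (row_mx (ulsubmx B) d') *m S.
  rewrite -[LHS]submxK urB dlB defB diag_mx_row /S tr_block_mx !trmx0 trmx1.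
  rewrite !mulmx_block !(mulmx0, mul0mx, mulmx1, mul1mx, addr0, add0r).
  congr (block_mx _ _ _ _); apply/matrixP => i j.
  by rewrite !ord1 !mxE eqxx mulr1n ?ord1.
exists (S *m Q), (row_mx (ulsubmx B) d'); split.
  by rewrite trmx_mul mulmxA -(mulmxA S) QQ mulmx1 SS.
rewrite trmx_mul mulmxA -!(mulmxA Q^T) -diagB BE !mulmxA QQ' mul1mx.
by rewrite -mulmxA QQ' mulmx1.
Qed.

(** * Inner product and orthonormal coordinates *)

Lemma dotE (R : realType) (n : nat) (u v : 'rV[R]_n) : dot u v = (u *m v^T) 0 0.
Proof. by rewrite mxE; apply: eq_bigr => k _; rewrite mxE. Qed.

Lemma dotZl (R : realType) (n : nat) (a : R) (u v : 'rV[R]_n) :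
  dot (a *: u) v = a * dot u v.
Proof. by rewrite !dotE -scalemxAl mxE. Qed.

Lemma dotZr (R : realType) (n : nat) (a : R) (u v : 'rV[R]_n) :
  dot u (a *: v) = a * dot u v.
Proof. by rewrite !dotE linearZ /= -scalemxAr mxE. Qed.

Lemma dot_ge0 (R : realType) (n : nat) (v : 'rV[R]_n) : 0 <= dot v v.
Proof. by apply: sumr_ge0 => k _; rewrite -expr2 sqr_ge0. Qed.

Lemma dot_eq0 (R : realType) (n : nat) (v : 'rV[R]_n) :
  (dot v v == 0) = (v == 0).
Proof.
apply/idP/eqP => [|->]; last by rewrite dotE mul0mx mxE.
rewrite psumr_eq0 => [/allP v0|k _]; last by rewrite -expr2 sqr_ge0.
apply/rowP => k; have := v0 k (mem_index_enum k).
by rewrite mulf_eq0 orbb mxE => /eqP.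
Qed.

Lemma enorm1E (R : realType) (n : nat) (v : 'rV[R]_n) :
  enorm v = 1 -> dot v v = 1.
Proof.
by move=> v1; rewrite -[LHS]sqr_sqrtr ?dot_ge0 // -/(enorm v) v1 expr1n.
Qed.

Lemma enorm_normalize (R : realType) (n : nat) (v : 'rV[R]_n) :
  v != 0 -> enorm ((enorm v)^-1 *: v) = 1.
Proof.
rewrite -dot_eq0 => v_neq0; rewrite /enorm dotZl dotZr mulrA -invfM -expr2.
by rewrite sqr_sqrtr ?dot_ge0 // mulVf // sqrtr1.
Qed.

(** Parseval: [v *m P^T] lists the coordinates of [v] in the orthonormal basis formed by the rows of
    [P]. *)
Lemma dot_coordinates (R : realType) (n : nat) (P : 'M[R]_n)
    (u v : 'rV[R]_n) :
  P *m P^T = 1%:M ->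
  dot u v = \sum_k (u *m P^T) 0 k * (v *m P^T) 0 k.
Proof.
move=> PP; rewrite -[RHS]/(dot (u *m P^T) (v *m P^T)) !dotE trmx_mul trmxK.
by rewrite mulmxA -(mulmxA u) (mulmx1C PP) mulmx1.
Qed.

Lemma mulmx_orthogonal_diag (R : realType) (n : nat) (P : 'M[R]_n)
    (d v : 'rV[R]_n) (k : 'I_n) :
  P *m P^T = 1%:M ->
  (v *m (P^T *m diag_mx d *m P) *m P^T) 0 k = d 0 k * (v *m P^T) 0 k.
Proof.
by move=> PP; rewrite -!mulmxA PP mulmx1 mulmxA mul_mx_diag mxE mulrC.
Qed.

Lemma char_poly_orthogonal_diag (R : realType) (n : nat) (P : 'M[R]_n)
    (d : 'rV[R]_n) :
  P *m P^T = 1%:M ->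
  char_poly (P^T *m diag_mx d *m P) = \prod_k ('X - (d 0 k)%:P).
Proof.
move=> PP; have QQ := mulmx1C PP.
have -> : \prod_k ('X - (d 0 k)%:P) = char_poly (diag_mx d).
  rewrite char_poly_trig ?diag_mx_is_trig //.
  by apply: eq_bigr => k _; rewrite mxE eqxx mulr1n.
pose PX := map_mx (@polyC R) P.
have QQX : PX^T *m PX = 1%:M by rewrite map_trmx -map_mxM QQ map_mx1.
have PPX : PX *m PX^T = 1%:M by exact: mulmx1C.
rewrite /char_poly; have -> : char_poly_mx (P^T *m diag_mx d *m P) =
    PX^T *m char_poly_mx (diag_mx d) *m PX.
  rewrite /char_poly_mx mulmxBr mulmxBl !map_mxM -map_trmx; congr (_ - _).
  by rewrite mul_mx_scalar -scalemxAl QQX scalemx1.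
by rewrite !det_mulmx mulrAC -det_mulmx QQX det1 mul1r.
Qed.

(** The diagonal found by [spectral_theorem] and [mu] are the roots of one polynomial, so they
    differ by a permutation, which the rows of [P] absorb. *)
Lemma ordered_spectral_theorem (R : realType) (n : nat) (A : 'M[R]_n)
    (mu : 'I_n -> R) :
    A^T = A -> ordered_eigenvalues A mu ->
  exists2 P : 'M[R]_n, P *m P^T = 1%:M & A = P^T *m diag_mx (\row_k mu k) *m P.
Proof.
move=> symA [_ charA]; have [P [d [PP defA]]] := spectral_theorem symA.
have /tuple_permP[s ds] : perm_eq [tuple d 0 k | k < n] [tuple mu k | k < n].
  apply: prod_XsubC_eq; rewrite !big_tuple.
  under eq_bigr do rewrite tnth_mktuple.
  rewrite -(char_poly_orthogonal_diag _ PP) -defA charA.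
  by apply: eq_bigr => k _; rewrite tnth_mktuple.
have dE k : d 0 k = mu (s k).
  have := congr1 (fun t => nth 0 t k) ds.
  by rewrite !nth_mktuple tnth_mktuple.
exists (row_perm s^-1 P).
  rewrite row_permE trmx_mul tr_perm_mx mulmxA -(mulmxA (perm_mx _)) PP mulmx1.
  by rewrite -perm_mxM mulgV perm_mx1.
have -> : diag_mx (\row_k mu k) = perm_mx s^-1 *m diag_mx d *m perm_mx s.
  rewrite -{2}[s]invgK -col_permE -row_permE; apply/matrixP => i j.
  by rewrite !mxE (inj_eq perm_inj) dE permKV.
rewrite row_permE trmx_mul tr_perm_mx invgK !mulmxA.
rewrite -(mulmxA P^T) -perm_mxM mulgV perm_mx1 mulmx1.
by rewrite -(mulmxA _ (perm_mx s)) -perm_mxM mulgV perm_mx1 mulmx1.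
Qed.

(** * Bounds by the spectral radius *)

Lemma norm_diag_le_spectral_radius (R : realType) (n : nat) (X P : 'M[R]_n)
    (d : 'rV[R]_n) :
    P *m P^T = 1%:M -> X = P^T *m diag_mx d *m P ->
  forall k, `|d 0 k| <= spectral_radius X.
Proof.
move=> PP defX k; apply: ub_le_sup.
  (* A supremum dominates its set only if the set is bounded above; the sum of all moduli is a crude
     bound. *)
  exists (\sum_j `|d 0 j|) => _ [z /= + <-].
  rewrite eigenvalue_root_char -map_char_poly defX char_poly_orthogonal_diag //.
  rewrite rmorph_prod /root horner_prod => /eqP/eqP/prodf_eq0[j _].
  rewrite rmorphB /= map_polyX map_polyC hornerXsubC subr_eq0 => /eqP->.
  rewrite /= expr0n /= addr0 sqrtr_sqr (bigD1 j) //= lerDl.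
  by apply: sumr_ge0.
exists (real_complex R (d 0 k)); last by rewrite /= expr0n addr0 sqrtr_sqr.
rewrite /= eigenvalue_root_char -map_char_poly fmorph_root defX.
rewrite char_poly_orthogonal_diag // (bigD1 k) //= rootM.
by rewrite root_XsubC eqxx.
Qed.

Lemma spectral_radius_ge0 (R : realType) (n : nat) (X : 'M[R]_n) :
  X^T = X -> (0 < n)%N -> 0 <= spectral_radius X.
Proof.
move=> symX n_gt0; have [P [d [PP defX]]] := spectral_theorem symX.
have := norm_diag_le_spectral_radius PP defX (Ordinal n_gt0).
exact: le_trans (normr_ge0 _).
Qed.

(** In an eigenbasis the quadratic form is a sum of squared coordinates weighted by the
    eigenvalues. *)
Lemma dot_symmetric_le (R : realType) (n : nat) (X : 'M[R]_n)
    (v : 'rV[R]_n) :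
  X^T = X -> `|dot (v *m X) v| <= spectral_radius X * dot v v.
Proof.
move=> symX; have [P [d [PP defX]]] := spectral_theorem symX.
have le_d := norm_diag_le_spectral_radius PP defX.
rewrite !(dot_coordinates _ _ PP) mulr_sumr (le_trans (ler_norm_sum _ _ _)) //.
apply: ler_sum => k _; rewrite [in leLHS]defX mulmx_orthogonal_diag // -mulrA.
by rewrite normrM -expr2 (ger0_norm (sqr_ge0 _)) ler_wpM2r ?sqr_ge0.
Qed.

(** As for the quadratic form, with squared eigenvalues as weights: the operator norm is at most the
    spectral radius. *)
Lemma dot_symmetric_image_le (R : realType) (n : nat) (X : 'M[R]_n)
    (v : 'rV[R]_n) :
  X^T = X ->
  dot (v *m X) (v *m X) <= spectral_radius X ^+ 2 * dot v v.
Proof.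
move=> symX; have [P [d [PP defX]]] := spectral_theorem symX.
have le_d := norm_diag_le_spectral_radius PP defX.
rewrite !(dot_coordinates _ _ PP) mulr_sumr.
apply: ler_sum => k _; rewrite [in leLHS]defX mulmx_orthogonal_diag //.
rewrite -!expr2 exprMn ler_wpM2r ?sqr_ge0 // -[leLHS]real_normK ?num_real //.
by rewrite ler_sqr ?nnegrE ?normr_ge0 ?(le_trans (normr_ge0 _) (le_d k)).
Qed.

(* Weyl's inequality. The [n - 1] linear conditions [x . P_k = 0] for [k > i]
   and [x . Q_k = 0] for [k < i] have a common nonzero solution [x], at which
   the two quadratic forms are compared. *)
Lemma weyl_le (R : realType) (n : nat) (A B : 'M[R]_n)
    (mu lambda : 'I_n -> R) (r : R) :
    A^T = A -> B^T = B ->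
    ordered_eigenvalues A mu -> ordered_eigenvalues B lambda ->
    (forall x, dot (x *m A) x <= dot (x *m B) x + r * dot x x) ->
  forall i, mu i <= lambda i + r.
Proof.
move=> symA symB Hmu Hlambda leAB i.
have [P PP defA] := ordered_spectral_theorem symA Hmu.
have [Q QQ defB] := ordered_spectral_theorem symB Hlambda.
(* Each column holds one linear condition; column [i] is left zero, so [M] is singular. *)
pose M := \matrix_(j, k)
  (if (k < i)%N then Q k j else if (i < k)%N then P k j else 0).
have /det0P[x xN0 xM] : \det M == 0.
  rewrite -det_tr (expand_det_row _ i) big1 // => j _.
  by rewrite !mxE ltnn mul0r.
have xPE k : (x *m P^T) 0 k = \sum_j x 0 j * P k j.
  by rewrite mxE; apply: eq_bigr => j _; rewrite mxE.
have xQE k : (x *m Q^T) 0 k = \sum_j x 0 j * Q k j.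
  by rewrite mxE; apply: eq_bigr => j _; rewrite mxE.
have xME k : \sum_j x 0 j * M j k = 0 by move/rowP/(_ k): xM; rewrite !mxE.
have xP (k : 'I_n) : (i < k)%N -> (x *m P^T) 0 k = 0.
  move=> ik; rewrite xPE -[RHS](xME k); apply: eq_bigr => j _.
  by rewrite mxE ltnNge (ltnW ik) /= ik.
have xQ (k : 'I_n) : (k < i)%N -> (x *m Q^T) 0 k = 0.
  move=> ki; rewrite xQE -[RHS](xME k).
  by apply: eq_bigr => j _; rewrite mxE ki.
have dot_gt0 : 0 < dot x x by rewrite lt0r dot_eq0 xN0 dot_ge0.
(* Only [P]-coordinates [k <= i] survive, where [mu k >= mu i], and only [Q]-coordinates [k >= i],
   where [lambda k <= lambda i]. *)
rewrite -(ler_pM2r dot_gt0) mulrDl; apply: le_trans (le_trans (leAB x) _).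
  rewrite !(dot_coordinates _ _ PP) mulr_sumr; apply: ler_sum => k _.
  rewrite defA mulmx_orthogonal_diag // mxE -mulrA -expr2.
  have [ik|ki] := ltnP i k; first by rewrite xP // expr0n !mulr0.
  by rewrite ler_wpM2r ?sqr_ge0 // (Hmu.1).
rewrite lerD2r !(dot_coordinates _ _ QQ) mulr_sumr; apply: ler_sum => k _.
rewrite defB mulmx_orthogonal_diag // mxE -mulrA -expr2.
have [ki|ik] := ltnP k i; first by rewrite xQ // expr0n !mulr0.
by rewrite ler_wpM2r ?sqr_ge0 // (Hlambda.1).
Qed.

(** * Spectral gap and projection onto an eigenspace *)

(** Replaces the extended reals by two real cases: an infinite gap, or a finite one with half-gap
    [h]. *)
Lemma smallest_gap_cases (R : realType) (n : nat) (mu : 'I_n -> R) (r : R) :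
    0 <= r -> (r%:E < smallest_gap mu / 2%:E)%E ->
  let c := fine (r%:E / (smallest_gap mu / 2%:E))%E in
  (c = 0 /\ forall j k, mu j = mu k) \/
  exists h, [/\ r < h, c = r / h &
    forall j k, mu j != mu k -> 2 * h <= `|mu j - mu k|].
Proof.
have gap_le j k : mu j != mu k -> (smallest_gap mu <= (`|mu j - mu k|)%:E)%E.
  exact: (@bigmin_le_cond _ (\bar R) _ +oo%E (j, k)
    (fun p : 'I_n * 'I_n => mu p.1 != mu p.2)).
move=> r_ge0; move: gap_le; case: (smallest_gap mu) => [g||] gap_le /=.
- rewrite inver pnatr_eq0 /= -EFinM lte_fin => rh; right; exists (g / 2).
  rewrite inver gt_eqF ?(le_lt_trans r_ge0) // -EFinM; split=> // j k jk.
  by rewrite mulrC divfK ?pnatr_eq0 // -lee_fin gap_le.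
(* The inverse of [+oo] is 0, hence [c = 0]; two distinct values of [mu] would make the gap
   finite. *)
- move=> _; left; split=> [|j k].
    by rewrite inver pnatr_eq0 /= gt0_mulye ?lte_fin ?invr_gt0 // invey mule0.
  by apply/eqP; apply: contraT => jk; have := gap_le j k jk.
- by rewrite inver pnatr_eq0 /= gt0_mulNye ?lte_fin ?invr_gt0.
Qed.

Lemma eigenvector_tail_le (R : realType) (n : nat) (A dA P : 'M[R]_n)
    (mu : 'I_n -> R) (l m h : R) (v : 'rV[R]_n) :
    dA^T = dA -> P *m P^T = 1%:M -> A = P^T *m diag_mx (\row_k mu k) *m P ->
    v *m (A + dA) = l *: v -> dot v v = 1 ->
    `|l - m| <= spectral_radius dA -> spectral_radius dA < h ->
    (forall k, mu k != m -> 2 * h <= `|mu k - m|) ->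
  \sum_(k | mu k != m) (v *m P^T) 0 k ^+ 2 <= (spectral_radius dA / h) ^+ 2.
Proof.
move=> symdA PP defA vl v1 le_lm lt_rh gap.
have h_gt0 : 0 < h by apply: le_lt_trans lt_rh; apply: le_trans le_lm.
have := dot_symmetric_image_le v symdA; rewrite v1 mulr1 => vdA_le.
rewrite expr_div_n ler_pdivlMr ?exprn_gt0 // mulr_suml; apply: le_trans vdA_le.
rewrite (dot_coordinates _ _ PP) [leRHS](bigID (fun k => mu k != m)) /=.
apply: ler_wpDr; first by apply: sumr_ge0 => k _; rewrite -expr2 sqr_ge0.
apply: ler_sum => k /gap gap_k.
have -> : v *m dA = l *: v - v *m A by rewrite -vl mulmxDr addrC addKr.
have -> : ((l *: v - v *m A) *m P^T) 0 k = (l - mu k) * (v *m P^T) 0 k.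
  have := mulmx_orthogonal_diag (\row_j mu j) v k PP; rewrite -defA mxE => vA.
  by rewrite mulmxBl -scalemxAl mulrBl -vA mxE [X in X + _]mxE [X in _ + X]mxE.
rewrite -expr2 exprMn mulrC ler_wpM2r ?sqr_ge0 //.
rewrite -[leRHS]real_normK ?num_real // ler_sqr ?nnegrE ?normr_ge0 ?ltW //.
(* [2 * h <= |mu k - m| <= |l - mu k| + |l - m|], and the last term is below [h]. *)
have := ler_distD l (mu k) m; rewrite (distrC (mu k) l); lra.
Qed.

(** [z *m P] is the projection of [v] onto the eigenspace and [s] its squared norm. By Pythagoras
    [s >= 1 - c ^+ 2 > 0], so it can be normalized, and its product with [v] is then
    [Num.sqrt s]. *)
Lemma eigenspace_projection (R : realType) (n : nat) (A P : 'M[R]_n)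
    (mu : 'I_n -> R) (m c : R) (v : 'rV[R]_n) :
    P *m P^T = 1%:M -> A = P^T *m diag_mx (\row_k mu k) *m P -> dot v v = 1 ->
    \sum_(k | mu k != m) (v *m P^T) 0 k ^+ 2 <= c ^+ 2 -> c ^+ 2 < 1 ->
  exists2 w, normed_eigenvector A m w & Num.sqrt (1 - c ^+ 2) <= dot v w.
Proof.
move=> PP defA v1 tail_le c_lt1.
pose y := v *m P^T; pose z := \row_k (if mu k == m then y 0 k else 0).
pose s := \sum_(k | mu k == m) y 0 k ^+ 2.
have s_ge : 1 - c ^+ 2 <= s.
  have := v1; rewrite (dot_coordinates _ _ PP) (bigID (fun k => mu k == m)) /=.
  under eq_bigr do rewrite -expr2.
  under [X in _ + X]eq_bigr do rewrite -expr2.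
  by rewrite -/y -/s => <-; rewrite lerBlDr lerD2l.
have s_gt0 : 0 < s by apply: lt_le_trans s_ge; rewrite subr_gt0.
have zPP : z *m P *m P^T = z by rewrite -mulmxA PP mulmx1.
have zz : dot (z *m P) (z *m P) = s.
  rewrite (dot_coordinates _ _ PP) zPP /s [RHS]big_mkcond /=.
  by apply: eq_bigr => k _; rewrite mxE; case: ifP => _; rewrite ?mulr0.
have vz : dot v (z *m P) = s.
  rewrite (dot_coordinates _ _ PP) zPP /s [RHS]big_mkcond /=.
  apply: eq_bigr => k _; rewrite [z _ _]mxE.
  by case: ifP => _; rewrite ?mulr0 -?expr2.
have sE : enorm (z *m P) = Num.sqrt s by rewrite /enorm zz.
have sqrt_gt0 : 0 < Num.sqrt s by rewrite sqrtr_gt0.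
exists ((enorm (z *m P))^-1 *: (z *m P)).
  split; last by rewrite enorm_normalize // -dot_eq0 zz gt_eqF.
  apply/scalemx_sub/eigenspaceP; rewrite defA 2!mulmxA -(mulmxA z) PP mulmx1.
  rewrite scalemxAl; congr (_ *m _); apply/rowP => k; rewrite mul_mx_diag !mxE.
  by case: eqP => [->|_]; rewrite ?mulr0 ?mul0r // mulrC.
have -> : dot v ((enorm (z *m P))^-1 *: (z *m P)) = Num.sqrt s.
  by rewrite dotZr vz sE -[X in _ * X]sqr_sqrtr ?ltW // expr2 mulKf ?gt_eqF.
exact: ler_wsqrtr.
Qed.

Theorem lemma6p2 (R : realType) (n : nat) (A dA : 'M[R]_n)
    (symA : A^T = A) (symdA : dA^T = dA)
    (lambda mu : 'I_n -> R)
    (Hlambda : ordered_eigenvalues (A + dA) lambda)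
    (Hmu : ordered_eigenvalues A mu)
    (Hgap : ((spectral_radius dA)%:E < smallest_gap mu / 2%:E)%E)
    (i : 'I_n) (v : 'rV[R]_n)
    (Hv : normed_eigenvector (A + dA) (lambda i) v) :
  [/\ `|lambda i - mu i| <= spectral_radius dA,
      (\rank (eigenspace (A + dA) (lambda i)) <=
       \rank (eigenspace A (mu i)))%N
    & exists2 w : 'rV[R]_n, normed_eigenvector A (mu i) w &
        dot v w >=
          Num.sqrt (1 - fine ((spectral_radius dA)%:E /
                              (smallest_gap mu / 2%:E))%E ^+ 2)].
Proof.
have symB : (A + dA)^T = A + dA by rewrite linearD /= symA symdA.
have dotB x : dot (x *m (A + dA)) x = dot (x *m A) x + dot (x *m dA) x.
  by rewrite !dotE mulmxDr mulmxDl mxE.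
have rho_ge0 : 0 <= spectral_radius dA.
  by apply: spectral_radius_ge0 => //; apply: leq_ltn_trans (ltn_ord i).
have dotdA x : - (spectral_radius dA * dot x x) <= dot (x *m dA) x
    <= spectral_radius dA * dot x x.
  by rewrite -ler_norml dot_symmetric_le.
(* Weyl's inequality in both directions, since the form of [dA] lies between the two multiples of
   [dot x x]. *)
have le_lm : `|lambda i - mu i| <= spectral_radius dA.
  rewrite ler_distl lerBlDr; apply/andP; split.
    apply: (weyl_le symA symB Hmu Hlambda) => x; rewrite dotB.
    by have /andP[] := dotdA x; lra.
  apply: (weyl_le symB symA Hlambda Hmu) => x; rewrite dotB.
  by have /andP[] := dotdA x; lra.
have [P PP defA] := ordered_spectral_theorem symA Hmu.
set c := fine _.
have [c_lt1 tail] : c ^+ 2 < 1 /\ forall u, u *m (A + dA) = lambda i *: u ->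
    dot u u = 1 -> \sum_(k | mu k != mu i) (u *m P^T) 0 k ^+ 2 <= c ^+ 2.
  have := smallest_gap_cases rho_ge0 Hgap; rewrite /= -/c.
  move=> [[-> mu_eq]|[h [rh -> gap]]].
    rewrite expr0n /= ltr01; split=> // u _ _.
    by rewrite big_pred0 // => k; rewrite (mu_eq k i) eqxx.
  have h_gt0 := le_lt_trans rho_ge0 rh; split=> [|u uB u1].
    by rewrite expr_lt1 // ?divr_ge0 ?ltr_pdivrMr ?mul1r // ltW.
  exact: eigenvector_tail_le symdA PP defA uB u1 le_lm rh (gap^~ i).
(* Stated for every [u], since the rank bound applies it to an eigenvector other than [v]. *)
have nearby u : normed_eigenvector (A + dA) (lambda i) u ->
    exists2 w, normed_eigenvector A (mu i) w & Num.sqrt (1 - c ^+ 2) <= dot u w.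
  case=> /eigenspaceP uB /enorm1E u1.
  exact: eigenspace_projection PP defA u1 (tail u uB u1) c_lt1.
split=> //; last exact: nearby.
(* Otherwise some eigenvector for [lambda i] is orthogonal to the eigenspace of
   [mu i], which contradicts [nearby] because [c < 1]. *)
rewrite leqNgt; apply/negP => rank_lt.
set E := eigenspace A (mu i) in rank_lt.
set F := eigenspace (A + dA) (lambda i) in rank_lt.
(* [kermx E^T] is the orthogonal complement of [E]; its rank [n - \rank E] and that of [F] add up to
   more than [n]. *)
have FE_neq0 : (F :&: kermx E^T)%MS != 0.
  rewrite -mxrank_eq0 -lt0n -(ltn_add2l (\rank (F + kermx E^T)%MS)) addn0.
  rewrite mxrank_sum_cap mxrank_ker mxrank_tr.
  rewrite (leq_ltn_trans (rank_leq_row _)) //.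
  by rewrite -{1}(subnKC (rank_leq_row E)) ltn_add2r.
have /rowV0Pn[u] := FE_neq0; rewrite sub_capmx => /andP[uF uE] u_neq0.
have [|w [/submxP[z wE] _]] := nearby ((enorm u)^-1 *: u).
  by split; [exact: scalemx_sub | exact: enorm_normalize].
rewrite dotZl dotE wE trmx_mul mulmxA (sub_kermxP uE) mul0mx mxE mulr0.
by rewrite leNgt sqrtr_gt0 subr_gt0 c_lt1.
Qed.
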